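(* Let $M$ be a compact metric space, $P$ a Markov Feller kernel on $M$, and $\mathcal{C}(M)\subset\mathcal{M}(M)$ a convex cone of measures which is stable by monotone convergence. Suppose that $P=Q+\Delta$ where: (i) $Q$ is a non-degenerate Feller sub-Markov kernel and $\Delta$ is a (possibly degenerate) sub-Markov kernel; (ii) $\mu Q\in\mathcal{C}(M)$ for every $\mu\in\mathcal{M}(M)$; (iii) $\mu\Delta\in\mathcal{C}(M)$ for every $\mu\in\mathcal{C}(M)$. Then $\mathsf{Inv}(P)\subset\mathcal{C}(M)$.
   Context: $M$ carries its Borel $\sigma$-field $\mathcal{B}(M)$; $\mathcal{M}(M)$ (resp. $\mathcal{P}(M)$) is the set of nonnegative finite (resp. probability) Borel measures on $M$. A convex cone of measures is a set $\mathcal{C}(M)\subset\mathcal{M}(M)$ such that $\alpha\mu+\beta\nu\in\mathcal{C}(M)$ for all $\mu,\nu\in\mathcal{C}(M)$, $\alpha,\beta\ge 0$. A bounded kernel on $M$ is a family $Q=\{Q(x,\cdot)\}_{x\in M}$ with $Q(x,\cdot)\in\mathcal{M}(M)$, $x\mapsto Q(x,A)$ measurable for every $A\in\mathcal{B}(M)$, and $\sup_x Q(x,M)<\infty$. It is non-degenerate if $Q(x,M)>0$ for all $x$; sub-Markov if $\sup_xQ(x,M)\le 1$; Markov if $Q(x,\cdot)\in\mathcal{P}(M)$ for all $x$; Feller if $f\mapsto Qf(x)=\int f(y)\,Q(x,dy)$ maps $C^0(M)$ into itself. For $\mu\in\mathcal{M}(M)$, $\mu Q(A)=\int\mu(dx)Q(x,A)$.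 For $P$ Markov, $\mathsf{Inv}(P)=\{\mu\in\mathcal{P}(M):\mu P=\mu\}$. $\mathcal{C}(M)$ is stable by monotone convergence if for every sequence $(\mu_n)_{n\ge0}$ in $\mathcal{C}(M)$ with $\mu_n\le\mu_{n+1}$ for all $n$ and such that the setwise limit $\mu(A)=\lim_n\mu_n(A)$, $A\in\mathcal{B}(M)$, is a finite measure, one has $\mu\in\mathcal{C}(M)$. *)

(* Defs.v *)
From HB Require Import structures.
From mathcomp Require Import all_boot all_order all_algebra.
From mathcomp Require Import all_classical all_reals all_analysis.

Set Implicit Arguments.
Unset Strict Implicit.
Unset Printing Implicit Defensive.
Import Order.TTheory GRing.Theory Num.Theory.
Import numFieldNormedType.Exports.

Local Open Scope classical_set_scope.
Local Open Scope ring_scope.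
Local Open Scope ereal_scope.

(* [measurableType] requires a point, so Borel sigma-algebras of the library
   only exist on pointed (i.e. non-empty) spaces. *)
#[short(type="pmetricType")]
HB.structure Definition PointedMetric (R : numDomainType) :=
  {M of Metric R M & Pointed M}.

Notation borel M := (g_sigma_algebraType (@open M)).

Section finite_measure_add.
Context d (T : measurableType d) (R : realType).
Variables mu nu : {finite_measure set T -> \bar R}.

HB.instance Definition _ := Measure.on (measure_add mu nu).

Let measure_add_fin : fin_num_fun (measure_add mu nu).
Proof.
move=> A mA; rewrite measure_addE fin_numD.
by rewrite !(fin_num_measure _ A mA).
Qed.

HB.instance Definition _ :=
  Measure_isFinite.Build _ _ _ (measure_add mu nu) measure_add_fin.

End finite_measure_add.

Section measure_kernel.
Context d d' (X : measurableType d) (Y : measurableType d') (R : realType).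
Variables (mu : {finite_measure set X -> \bar R}) (Q : R.-fker X ~> Y).

(* The measure mu Q : A |-> \int mu(dx) Q(x, A). *)
Definition mkernel (A : set Y) : \bar R := \int[mu]_x Q x A.

Let mkernel0 : mkernel set0 = 0.
Proof. by apply: integral0_eq => x _; rewrite measure0. Qed.

Let mkernel_ge0 A : 0 <= mkernel A.
Proof. exact: integral_ge0. Qed.

Let mkernel_sigma_additive : semi_sigma_additive mkernel.
Proof.
move=> F mF tF mUF; rewrite [X in _ --> X](_ : _ =
    \int[mu]_x (\sum_(n <oo) Q x (F n))); last first.
  apply: eq_integral => x _; apply/esym/cvg_lim => //.
  exact/measure_semi_sigma_additive.
apply/cvg_closeP; split.
  by apply: is_cvg_nneseries => n _ _; exact: integral_ge0.
rewrite closeE// integral_nneseries// => n.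
exact: measurable_kernel.
Qed.

HB.instance Definition _ := isMeasure.Build _ _ _ mkernel
  mkernel0 mkernel_ge0 mkernel_sigma_additive.

Let mkernel_fin : fin_num_fun mkernel.
Proof.
have [r Qr] := measure_uub Q; apply: lty_fin_num_fun.
have mQ := measurable_kernel Q _ measurableT.
have Qr' x : Q x setT <= cst r%:E x by exact: ltW.
have r0 : 0 <= r%:E by exact: le_trans (Qr' point).
have le_int : \int[mu]_x Q x setT <= \int[mu]_x cst r%:E x.
  exact: ge0_le_integral.
apply: (le_lt_trans le_int).
rewrite integral_cst// -ge0_fin_numE ?mule_ge0//.
by rewrite fin_numM// fin_num_measure.
Qed.

HB.instance Definition _ := Measure_isFinite.Build _ _ _ mkernel mkernel_fin.

End measure_kernel.

Section measure_cones.
Context d (T : measurableType d) (R : realType).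
Implicit Types C : set {finite_measure set T -> \bar R}.

Definition convex_cone C :=
  forall (mu nu : {finite_measure set T -> \bar R}) (a b : {nonneg R}),
    C mu -> C nu -> C (measure_add (mscale a mu) (mscale b nu)).

(* Measures are total functions on [set T] that are only relevant on measurable
   sets. Constant sequences show that the predicate below entails that C does
   not distinguish two measures agreeing on measurable sets. *)
Definition stable_monotone_cvg C :=
  forall (mu_ : {finite_measure set T -> \bar R}^nat)
         (mu : {finite_measure set T -> \bar R}),
    (forall n, C (mu_ n)) ->
    (forall n A, measurable A -> mu_ n A <= mu_ n.+1 A) ->
    (forall A, measurable A -> mu_ n A @[n --> \oo] --> mu A) ->
    C mu.

End measure_cones.

Section kernels.
Context (R : realType) (M : pmetricType R).

Definition feller (Q : R.-fker (borel M) ~> (borel M)) :=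
  forall f : M -> R, continuous f ->
    continuous (fun x : M => (\int[Q x]_y f y)%R).

Definition non_degenerate (Q : R.-fker (borel M) ~> (borel M)) :=
  forall x, 0 < Q x [set: borel M].

Definition invariant_probability (P : R.-pker (borel M) ~> (borel M)) :
    set (probability (borel M) R) :=
  [set mu : probability (borel M) R |
    forall A, measurable A -> mkernel mu P A = mu A].

End kernels.

(* Main.v *)
(** By compactness [Q x M >= e] for some [e > 0], hence [Delta x M <= 1 - e].
Iterating [mu = mu Q + mu Delta] gives
[mu = \sum_(k <= n) mu Q Delta^k + mu Delta^(n+1)], whose last term has mass at
most [(1 - e)^(n+1)]. The partial sums belong to [C] and increase to [mu]. *)
Require Import Defs.
From HB Require Import structures.
From mathcomp Require Import all_boot all_order all_algebra.
From mathcomp Require Import all_classical all_reals all_analysis.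

Set Implicit Arguments.
Unset Strict Implicit.
Unset Printing Implicit Defensive.
Import Order.TTheory GRing.Theory Num.Theory.
Import numFieldNormedType.Exports.

Local Open Scope classical_set_scope.
Local Open Scope ring_scope.
Local Open Scope ereal_scope.

Section mkernel_theory.
Context d d' (X : measurableType d) (Y : measurableType d') (R : realType).
Implicit Types (mu nu : {finite_measure set X -> \bar R}) (K : R.-fker X ~> Y).

(** The hypothesis covers measurable sets only, so [mu] and [nu] may differ as functions and cannot
    simply be rewritten into each other. *)
Lemma eq_mkernel mu nu K A : (forall B, measurable B -> mu B = nu B) ->
  mkernel mu K A = mkernel nu K A.
Proof. by move=> munu; apply: eq_measure_integral => B mB _; exact: munu. Qed.

Lemma le_mkernel mu nu K A : measurable A ->
  (forall B, measurable B -> mu B <= nu B) ->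
  mkernel mu K A <= mkernel nu K A.
Proof.
by move=> mA munu; apply: ge0_le_measure_integral => //; exact: measurable_kernel.
Qed.

Lemma mkernelDl mu nu K A : measurable A ->
  mkernel (measure_add mu nu) K A = mkernel mu K A + mkernel nu K A.
Proof.
by move=> mA; apply: ge0_integral_measure_add => //; exact: measurable_kernel.
Qed.

Lemma mkernelDr mu K K1 K2 A : measurable A ->
  (forall x, K x A = K1 x A + K2 x A) ->
  mkernel mu K A = mkernel mu K1 A + mkernel mu K2 A.
Proof.
move=> mA KE; rewrite /mkernel -ge0_integralD//; try exact: measurable_kernel.
by apply: eq_integral => x _; rewrite KE.
Qed.

Lemma mkernelT_le mu K (c : R) : (0 <= c)%R ->
  (forall x, K x setT <= c%:E) -> mkernel mu K setT <= c%:E * mu setT.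
Proof.
move=> c0 Kc; rewrite -integral_cst//.
by apply: ge0_le_integral => //; exact: measurable_kernel.
Qed.

End mkernel_theory.

Lemma fin_num_fkernelT d d' (X : measurableType d) (Y : measurableType d')
    (R : realType) (K : R.-fker X ~> Y) x : K x setT \is a fin_num.
Proof.
have [r Kr] := measure_uub K.
by rewrite ge0_fin_numE// (lt_trans (Kr x)) ?ltry.
Qed.

(** The Feller property applied to the constant function 1 makes the total mass continuous in [x].
    By compactness it attains its minimum, which is positive by non-degeneracy. *)
Lemma feller_total_mass_lbound (R : realType) (M : pmetricType R)
    (Q : R.-fker (borel M) ~> (borel M)) :
  compact [set: M] -> feller Q -> non_degenerate Q ->
  exists2 e : R, (0 < e)%R & forall x, e%:E <= Q x setT.
Proof.
move=> cM fQ ndQ.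
have cQ : continuous (fun x : M => fine (Q x setT)).
  move=> x; have := fQ _ (@cst_continuous M R 1%R) x.
  by under eq_fun do rewrite Rintegral_cst// mul1r.
have [|x _ xmin] := compact_EVT_min _ cM (continuous_subspaceT cQ).
  by exists point.
exists (fine (Q x setT)).
  by rewrite fine_gt0// ndQ/= -ge0_fin_numE// fin_num_fkernelT.
by move=> y; rewrite -[leRHS]fineK ?fin_num_fkernelT// lee_fin xmin ?inE.
Qed.

Section kernel_series.
Context d (T : measurableType d) (R : realType).
Variable K : R.-fker T ~> T.
Implicit Types mu nu : {finite_measure set T -> \bar R}.

Fixpoint kernel_iter mu n : {finite_measure set T -> \bar R} :=
  if n is n'.+1 then mkernel (kernel_iter mu n') K else mu.

(* The partial sums [\sum_(k <= n) nu K^k] in Horner form; the unit scalings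
   match the shape of the combinations in [convex_cone]. *)
Fixpoint kernel_series nu n : {finite_measure set T -> \bar R} :=
  if n is n'.+1 then
    measure_add (mscale 1%R%:nng%R nu)
      (mscale 1%R%:nng%R (mkernel (kernel_series nu n') K))
  else nu.

Lemma kernel_seriesS nu n A :
  kernel_series nu n.+1 A = nu A + mkernel (kernel_series nu n) K A.
Proof. by rewrite /= measure_addE; congr (_ + _); exact: mul1e. Qed.

(** In Horner form, the order between consecutive sums propagates because [mkernel] is monotone in
    the measure. *)
Lemma kernel_series_nondecreasing nu n A : measurable A ->
  kernel_series nu n A <= kernel_series nu n.+1 A.
Proof.
elim: n A => [|n IH] A mA; rewrite kernel_seriesS; first exact: leeDl.
by rewrite kernel_seriesS leeD2l// le_mkernel.
Qed.

(** Substitute the decomposition at rank [n] for [mu] inside [mkernel mu K], then use additivity in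
    the measure. *)
Lemma kernel_seriesD_iter mu nu n A :
  (forall B, measurable B -> mu B = nu B + mkernel mu K B) -> measurable A ->
  mu A = kernel_series nu n A + kernel_iter mu n.+1 A.
Proof.
move=> muE; elim: n A => [|n IH] A mA; first exact: muE.
rewrite kernel_seriesS -addeA [kernel_iter _ _.+2]/= -mkernelDl// muE//.
by congr (_ + _); apply: eq_mkernel => B mB; rewrite [RHS]measure_addE; exact: IH.
Qed.

Lemma kernel_iterT_le mu n (c : R) : (0 <= c)%R ->
  (forall x, K x setT <= c%:E) -> kernel_iter mu n setT <= (c ^+ n)%:E * mu setT.
Proof.
move=> c0 Kc; elim: n => [|n IH]; first by rewrite expr0 mul1e.
apply: (le_trans (mkernelT_le _ c0 Kc)).
by rewrite exprS EFinM -muleA lee_wpmul2l.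
Qed.

(** The mass of [A] is at most the total mass, which decays geometrically. *)
Lemma cvg_kernel_iter mu (c : R) A : (0 <= c < 1)%R ->
  (forall x, K x setT <= c%:E) -> measurable A ->
  kernel_iter mu n A @[n --> \oo] --> 0.
Proof.
move=> /andP[c0 c1] Kc mA.
have bnd : \forall n \near \oo,
    0 <= kernel_iter mu n A <= (geometric (fine (mu setT)) c n)%:E.
  apply: nearW => n; rewrite measure_ge0/=.
  apply: (le_trans (le_measure _ _ _ (@subsetT _ A))); rewrite ?inE//.
  apply: (le_trans (kernel_iterT_le _ _ c0 Kc)).
  by rewrite EFinM fineK ?fin_num_measure// muleC.
apply: (squeeze_cvge bnd); first exact: cvg_cst.
apply: cvg_EFin; first exact: nearW.
by apply: cvg_geometric; rewrite ger0_norm.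
Qed.

Lemma cvg_kernel_series mu nu (c : R) A : (0 <= c < 1)%R ->
  (forall x, K x setT <= c%:E) ->
  (forall B, measurable B -> mu B = nu B + mkernel mu K B) -> measurable A ->
  kernel_series nu n A @[n --> \oo] --> mu A.
Proof.
move=> c01 Kc muE mA.
have -> : (fun n => kernel_series nu n A) =
    (fun n => mu A - kernel_iter mu n.+1 A).
  (* Cancelling the remainder is legitimate since its value is finite. *)
  apply/funext => n; rewrite (kernel_seriesD_iter n muE mA) addeK//.
  exact: fin_num_measure.
rewrite -[X in _ --> X]sube0; apply: cvgeB.
- exact: fin_num_adde_defl.
- exact: cvg_cst.
(* The remainder is the iterate of rank [n.+1], hence the shift. *)
- have := cvg_kernel_iter mu c01 Kc mA.
  by rewrite -(cvg_shiftS (fun n => kernel_iter mu n A)).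
Qed.

End kernel_series.

Theorem theorem2p6 (R : realType) (M : pmetricType R)
    (cM : compact [set: M])
    (P : R.-pker (borel M) ~> (borel M)) (fellerP : feller P)
    (C : set {finite_measure set (borel M) -> \bar R})
    (coneC : convex_cone C) (stableC : stable_monotone_cvg C)
    (Q Delta : R.-spker (borel M) ~> (borel M))
    (PQD : forall (x : M) (A : set (borel M)), measurable A ->
       P x A = Q x A + Delta x A)
    (ndQ : non_degenerate Q) (fellerQ : feller Q)
    (QC : forall mu : {finite_measure set (borel M) -> \bar R},
       C (mkernel mu Q))
    (DeltaC : forall mu : {finite_measure set (borel M) -> \bar R},
       C mu -> C (mkernel mu Delta)) :
  forall mu : probability (borel M) R, invariant_probability P mu -> C mu.
Proof.
move=> mu invmu.
have [e e0 Qe] := feller_total_mass_lbound cM fellerQ ndQ.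
have e1 : (e <= 1)%R.
  by rewrite -lee_fin (le_trans (Qe point))// sprob_kernel_le1.
have DeltaT x : Delta x setT <= (1 - e)%:E.
  (* Here 1 is the total mass of [P x], which splits into those of [Q x] and [Delta x]. *)
  rewrite EFinB leeBrDr// -(@prob_kernel _ _ _ _ _ P x) PQD// addeC.
  by apply: leeD2r; exact: Qe.
apply: (stableC (kernel_series Delta (mkernel mu Q))).
(* Each new sum is a combination with weights 1 of [mu Q], in [C] by [QC], and of the image under
   [Delta] of the previous sum. *)
- by elim=> [|n IH]; [exact: QC | apply: coneC; [exact: QC | exact: DeltaC]].
- by move=> n A; exact: kernel_series_nondecreasing.
- move=> A; apply: (cvg_kernel_series _ DeltaT).
    by rewrite subr_ge0 e1 ltrBlDr ltrDl.
  (* Invariance turns [mu] into [mu P], so splitting [P] yields the fixed-point equation with [nu]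
     equal to [mu Q]. *)
  move=> B mB; rewrite -[LHS](invmu _ mB).
  by apply: mkernelDr => // x; exact: PQD.
Qed.
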